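(* Let $\mathcal{M}=(S,\mathit{Act},\mathbf{P},s_I)$ be an MDP, $\mathcal{Q}=(\psi_1,\dots,\psi_\ell)$ a query with $\psi_j=\mathbb{E}_{\sim_j}(\mathbf{R}_j\lozenge\emptyset)$ (all objectives total reward objectives), and $\vec p\in\mathbb{R}^\ell$. Assume (i) $\mathcal{M}$ has exactly one end component, and (ii) for every $j$, state $s$ and pure stationary strategy $\sigma$, $\mathbb{E}^{\sigma}_{\mathcal{M}_s}(\mathbf{R}_j\lozenge\emptyset)<\infty$. Let $X_s\in\mathbb{Q}$ (for $s\in S_?$) satisfy $X_s\ge\mathbb{E}^\sigma_{\mathcal{M}}(\mathbf{R}_{s,\alpha}\lozenge S_0)$ for all pure stationary $\sigma$ and all $\alpha\in\mathit{Act}(s)$. Then the constraint system $\mathcal{C}_2$ described in the context has a solution if and only if $\vec p\in\mathrm{Ach}_{PS}(\mathcal{M},\mathcal{Q})$.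
   Context: MDP: $\mathcal{M}=(S,\mathit{Act},\mathbf{P},s_I)$, $S,\mathit{Act}$ finite, $\mathbf{P}\colon S\times\mathit{Act}\times S\to[0,1]$ with $\sum_{s'}\mathbf{P}(s,\alpha,s')\in\{0,1\}$; $\mathit{Act}(s)=\{\alpha\mid\exists s'.\mathbf{P}(s,\alpha,s')>0\}\neq\emptyset$; $\mathcal{M}_s$ is $\mathcal{M}$ with initial state $s$. A (general) strategy maps finite paths to distributions over enabled actions; a pure stationary strategy is $\sigma\colon S\to\mathit{Act}$ with $\sigma(s)\in\mathit{Act}(s)$; $\mathbb{E}^\sigma_{\mathcal{M}}$ is the expectation under the induced path measure. For reward structure $\mathbf{R}\colon S\times\mathit{Act}\times S\to\mathbb{R}_{\ge0}$, $G\subseteq S$ and path $\pi=s_0\alpha_1s_1\dots$, $(\mathbf{R}\lozenge G)(\pi)=\sum_{i=1}^{n}\mathbf{R}(s_{i-1},\alpha_i,s_i)$, $n$ the least index with $s_n\in G$ ($\infty$ if none); for $G=\emptyset$ this is the total accumulated reward. ${\sim_j}\in\{\ge,\le\}$. $\vec p$ is achieved by $\sigma$ if $\mathbb{E}^\sigma_{\mathcal{M}}(\mathbf{R}_j\lozenge G_j)\sim_j p_j$ for all $j$; $\mathrm{Ach}_{PS}(\mathcal{M},\mathcal{Q})$ is the set of points achieved by some pure stationary strategy. A set $\mathcal{E}\subseteq S\times\mathit{Act}$ is closed if for all $(s,\alpha)\in\mathcal{E}$, $\alpha\in\mathit{Act}(s)$ and all successors $s'$ ($\mathbf{P}(s,\alpha,s')>0$)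 lie in $S_{\mathcal{E}}=\{s\mid\exists\alpha.(s,\alpha)\in\mathcal{E}\}$; an end component is a nonempty closed $\mathcal{E}$ whose states are mutually reachable using only transitions from $\mathcal{E}$. Let $S_0^j=\{s\mid\mathbb{E}^\sigma_{\mathcal{M}_s}(\mathbf{R}_j\lozenge\emptyset)=0\text{ for all strategies }\sigma\}$, $S_0=\bigcap_jS_0^j$, $S_?=S\setminus S_0$. For $s\in S$, $\alpha\in\mathit{Act}$, $\mathbf{R}_{s,\alpha}(\hat s,\hat\alpha,s')=[\hat s=s\wedge\hat\alpha=\alpha]$. The system $\mathcal{C}_2$ has variables $a_{s,\alpha}$ ($s\in S,\alpha\in\mathit{Act}(s)$), $y_{s,\alpha}$ ($s\in S_?,\alpha\in\mathit{Act}(s)$), $x^j$ ($j=1..\ell$), and constraints: for all $s\in S$: $a_{s,\alpha}\in\{0,1\}$, $\sum_{\alpha\in\mathit{Act}(s)}a_{s,\alpha}=1$; for all $s\in S_?$, $\alpha\in\mathit{Act}(s)$: $0\le y_{s,\alpha}\le X_s a_{s,\alpha}$; for all $s\in S_?$: $\sum_{\alpha\in\mathit{Act}(s)}y_{s,\alpha}=[s=s_I]+\sum_{(s',\alpha'):\,s'\in S_?,\,\mathbf{P}(s',\alpha',s)>0}\mathbf{P}(s',\alpha',s)\,y_{s',\alpha'}$; $1=\sum_{s\in S_?}\sum_{\alpha\in\mathit{Act}(s)}y_{s,\alpha}\sum_{s'\in S_0}\mathbf{P}(s,\alpha,s')$; for all $j$: $x^j=\sum_{s\in S_?}\sum_{\alpha\in\mathit{Act}(s)}y_{s,\alpha}\sum_{s'\in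 S}\mathbf{P}(s,\alpha,s')\mathbf{R}_j(s,\alpha,s')$ and $x^j\sim_jp_j$.
   Formalization: The formal theorem additionally assumes $s_I\in S_?$; if $s_I\in S_0$ the system $\mathcal{C}_2$ is unsatisfiable (its flow has no source, contradicting $1=\dots$), while e.g. $\vec p=0$ with all $\sim_j$ equal to $\le$ is achieved, so the statement fails there. *)

(* Defs.v *)
From HB Require Import structures.
From mathcomp Require Import all_boot all_order all_algebra.
From mathcomp Require Import all_classical all_reals all_analysis.

Set Implicit Arguments.
Unset Strict Implicit.
Unset Printing Implicit Defensive.

Import Order.TTheory GRing.Theory Num.Theory.
Local Open Scope classical_set_scope.
Local Open Scope ring_scope.

Record mdp (R : realType) (S Act : finType) := MDP {
  trans : S -> Act -> S -> R ;
  init : S ;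
  trans_01 : forall s a s', 0 <= trans s a s' <= 1 ;
  trans_sum : forall s a,
    \sum_(s' : S) trans s a s' = 0 \/ \sum_(s' : S) trans s a s' = 1 ;
  trans_enabled : forall s, exists a, [exists s', 0 < trans s a s'] }.

Record reward (R : realType) (S Act : finType) := Reward {
  reward_fun :> S -> Act -> S -> R ;
  reward_ge0 : forall s a s', 0 <= reward_fun s a s' }.

Inductive comparison := GeObj | LeObj.

Definition compare_sem (d : Order.disp_t) (T : porderType d) (c : comparison)
    (x y : T) : bool :=
  match c with GeObj => (y <= x)%O | LeObj => (x <= y)%O end.

Record objective (R : realType) (S Act : finType) := Objective {
  obj_cmp : comparison ;
  obj_reward : reward R S Act ;
  obj_goal : {set S} }.

Section MDP.
Context {R : realType} {S Act : finType}.
Implicit Types (M : mdp R S Act) (s : S) (a : Act).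

Definition enabled M s a : bool := [exists s', 0 < trans M s a s'].

Definition mdp_at M s : mdp R S Act :=
  MDP s (trans_01 M) (trans_sum M) (trans_enabled M).

(* The finite path s_0 a_1 s_1 ... a_n s_n is represented by its history
   [:: (s_0, a_1); ...; (s_(n-1), a_n)] together with its last state s_n. *)
Definition strategy := seq (S * Act) -> S -> Act -> R.

Definition is_strategy M (sigma : strategy) : Prop :=
  forall h s,
    [/\ forall a, 0 <= sigma h s a,
        \sum_(a : Act) sigma h s a = 1
      & forall a, sigma h s a != 0 -> enabled M s a].

Definition pure_stationary M (sigma : S -> Act) : Prop :=
  forall s, enabled M s (sigma s).

Definition strategy_of_ps (sigma : S -> Act) : strategy :=
  fun _ s a => (a == sigma s)%:R.

(* The infinite path s_0 a_1 s_1 a_2 ... is the sequence i |-> (s_i, a_(i+1)).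
   Sequences that use a transition of probability 0 are kept; they form a null
   set.  The MDP is a parameter only because measurable types are pointed. *)
Definition run M : Type := nat -> S * Act.

HB.instance Definition _ M := Choice.copy (run M) (nat -> S * Act)%type.
HB.instance Definition _ M := isPointed.Build (run M)
  (fun=> (init M, xchoose (trans_enabled M (init M)))).

(* The cylinder set of the finite path that consists of the first n
   state-action pairs of w followed by the n-th state of w; every finite path
   has this form. *)
Definition cylinder M (n : nat) (w : run M) : set (run M) :=
  [set pi : run M | (forall i, (i < n)%N -> pi i = w i) /\
                    (pi n).1 = (w n).1].

Definition cylinder_prob M (sigma : strategy) (n : nat) (w : run M) : R :=
  ((w 0%N).1 == init M)%:R *
  \prod_(i < n) (sigma (mkseq w i) (w i).1 (w i).2 *
                 trans M (w i).1 (w i).2 (w i.+1).1).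

Definition cylinders M : set (set (run M)) :=
  [set A | exists n w, A = cylinder n w].

Definition runs M := g_sigma_algebraType (@cylinders M).

(* The probability measure on infinite paths induced by a strategy, i.e. the one
   (it exists and is unique by Ionescu-Tulcea, when is_strategy M sigma holds)
   that takes the expected values on all cylinder sets. *)
Definition path_measure M (sigma : strategy) : probability (runs M) R :=
  get [set mu : probability (runs M) R |
        forall n (w : run M),
          mu (cylinder n w) = (cylinder_prob sigma n w)%:E].

Definition step_reward M (rew : reward R S Act) (pi : run M) (i : nat) : R :=
  rew (pi i).1 (pi i).2 (pi i.+1).1.

Definition reward_until M (rew : reward R S Act) (G : {set S}) (pi : run M) :
    \bar R :=
  match pselect (exists n, (pi n).1 \in G) with
  | left hit => (\sum_(i < ex_minn hit) step_reward rew pi i)%:E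
  | right _ => (\sum_(0 <= i <oo) (step_reward rew pi i)%:E)%E
  end.

Definition expected_reward M (sigma : strategy) (rew : reward R S Act)
    (G : {set S}) : \bar R :=
  (\int[path_measure M sigma]_pi @reward_until M rew G pi)%E.

Definition achieved_by M (l : nat) (Q : 'I_l -> objective R S Act)
    (p : 'rV[R]_l) (sigma : strategy) : Prop :=
  forall j, compare_sem (obj_cmp (Q j))
    (expected_reward M sigma (obj_reward (Q j)) (obj_goal (Q j)))
    (p ord0 j)%:E.

Definition Ach_PS M (l : nat) (Q : 'I_l -> objective R S Act) : set 'rV[R]_l :=
  [set p | exists sigma : S -> Act,
     pure_stationary M sigma /\ achieved_by M Q p (strategy_of_ps sigma)].

Definition states_of (E : {set S * Act}) : {set S} :=
  [set s | [exists a, (s, a) \in E]]%SET.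

Definition closed_sa M (E : {set S * Act}) : Prop :=
  forall s a, (s, a) \in E ->
    enabled M s a /\ (forall s', 0 < trans M s a s' -> s' \in states_of E).

Definition edge_in M (E : {set S * Act}) : rel S :=
  fun s s' => [exists a, ((s, a) \in E) && (0 < trans M s a s')].

Definition end_component M (E : {set S * Act}) : Prop :=
  [/\ E != finset.set0,
      closed_sa M E
    & forall s s', s \in states_of E -> s' \in states_of E ->
        connect (edge_in M E) s s'].

Definition zero_states M (rew : reward R S Act) : {set S} :=
  [set s | `[< forall sigma, is_strategy M sigma ->
      expected_reward (mdp_at M s) sigma rew finset.set0 = 0%E >]]%SET.

Definition S_zero M (l : nat) (Q : 'I_l -> objective R S Act) : {set S} :=
  (\bigcap_(j < l) zero_states M (obj_reward (Q j)))%SET.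

Definition S_maybe M (l : nat) (Q : 'I_l -> objective R S Act) : {set S} :=
  (~: S_zero M Q)%SET.

Definition visit_reward s a : reward R S Act :=
  @Reward R S Act (fun s1 a1 _ => ((s1 == s) && (a1 == a))%:R)
    (fun _ _ _ => ler0n _ _).

(* The variables a s al and y s al matter only for enabled al (and, for y, for
   s \in S_maybe M Q); all other values are unconstrained and unused. *)
Definition C2 M (l : nat) (Q : 'I_l -> objective R S Act) (p : 'rV[R]_l)
    (X : S -> rat) (a y : S -> Act -> R) (x : 'rV[R]_l) : Prop :=
  let P := trans M in
  let S0 := S_zero M Q in
  let Sq := S_maybe M Q in
  [/\ forall s, (forall al, enabled M s al -> a s al = 0 \/ a s al = 1) /\
        \sum_(al | enabled M s al) a s al = 1,
      forall s al, s \in Sq -> enabled M s al ->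
        0 <= y s al <= ratr (X s) * a s al,
      forall s, s \in Sq ->
        \sum_(al | enabled M s al) y s al =
        (s == init M)%:R +
        \sum_(t : S * Act | (t.1 \in Sq) && (0 < P t.1 t.2 s))
          P t.1 t.2 s * y t.1 t.2,
      1 = \sum_(s in Sq) \sum_(al | enabled M s al)
            y s al * \sum_(s' in S0) P s al s'
    & forall j,
        x ord0 j = \sum_(s in Sq) \sum_(al | enabled M s al)
          y s al * \sum_(s' : S) P s al s' * obj_reward (Q j) s al s' /\
        compare_sem (obj_cmp (Q j)) (x ord0 j) (p ord0 j)].

End MDP.

(* Main.v *)
Require Import Defs.
From HB Require Import structures.
From mathcomp Require Import all_boot all_order all_algebra.
From mathcomp Require Import all_classical all_reals all_analysis.
From mathcomp Require Import measurable_realfun.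
Import Order.TTheory GRing.Theory Num.Theory.
Local Open Scope ring_scope.

Set Implicit Arguments.
Unset Strict Implicit.
Unset Printing Implicit Defensive.

(** The path measure of a strategy is the image of Lebesgue measure on [0,
    1[ under a coding of infinite paths by nested intervals whose lengths
    are the probabilities of the finite prefixes.  The expected total reward
    is the series, over the steps, of finite sums of path probabilities.
    Hence, under a pure stationary strategy, the expected numbers of visits
    of the states of S_? form a flow in the sense of C2; they are finite by
    the bounds X_s, and summing the flow equations yields the absorption
    equation.  Conversely, a solution of C2 is a flow of the strategy
    selected by its 0/1 variables.  It dominates the expected visits, and
    the difference is an invariant measure that never leaves S_?.  If this
    were nonzero, its support would contain an end component inside S_?; but
    S_0 is closed and, by the absorption equation, nonempty, so that it
    contains a second end component. *)

(** * Coding infinite words by points of the unit interval *)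

Section interval_coding.
Local Open Scope classical_set_scope.
Context {R : realType} {T : finType}.

Section cumulative_weights.
Variable w : T -> R.
Hypothesis w_ge0 : forall x, 0 <= w x.

(** The distribution function of [w] along the enumeration of [T]: the half-open intervals from
    [cumul (enum_rank x)] to [cumul (enum_rank x) + w x] tile the interval from 0 to the total
    weight. *)
Definition cumul (n : nat) : R := \sum_(y | (enum_rank y < n)%N) w y.

Lemma cumulS (x : T) : cumul (enum_rank x).+1 = cumul (enum_rank x) + w x.
Proof.
rewrite /cumul (bigD1 x) //= addrC; congr (_ + _).
apply: eq_bigl => y; rewrite ltnS [RHS]ltn_neqAle andbC; congr (_ && _).
by rewrite (inj_eq val_inj) (inj_eq enum_rank_inj).
Qed.

Lemma le_cumul m n : (m <= n)%N -> cumul m <= cumul n.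
Proof.
move=> mn; rewrite /cumul (big_mkcond (fun y => _ < m)%N).
rewrite (big_mkcond (fun y => _ < n)%N) /=; apply: ler_sum => y _.
case: ifP => [ym|_]; first by rewrite (leq_trans ym mn).
by case: ifP.
Qed.

Lemma cumul_total : cumul #|T| = \sum_x w x.
Proof. by apply: eq_bigl => x; rewrite ltn_ord. Qed.

Lemma cumul_ge0 n : 0 <= cumul n.
Proof. exact: sumr_ge0. Qed.

(** The letter found is the first one whose weight lifts the cumulative sum above [v]. *)
Lemma cumul_cover (v : R) : 0 <= v < \sum_x w x ->
  exists x, cumul (enum_rank x) <= v < cumul (enum_rank x) + w x.
Proof.
rewrite -cumul_total => /andP[v0].
suff H n : (n <= #|T|)%N -> v < cumul n ->
    exists x, cumul (enum_rank x) <= v < cumul (enum_rank x) + w x.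
  exact: H.
elim: n => [|n IH] ltnT; first by rewrite /cumul big_pred0_eq ltNge v0.
have [/IH IH' _|nv] := ltP v (cumul n); first exact/IH'/ltnW.
pose x := enum_val (Ordinal ltnT).
have rx : enum_rank x = n :> nat by rewrite /x enum_valK.
by rewrite -rx cumulS => vlt; exists x; rewrite rx nv -rx.
Qed.

Lemma cumul_disjoint (v : R) (x y : T) :
  cumul (enum_rank x) <= v < cumul (enum_rank x) + w x ->
  cumul (enum_rank y) <= v < cumul (enum_rank y) + w y -> x = y.
Proof.
rewrite -!cumulS => /andP[x1 x2] /andP[y1 y2].
case: (ltngtP (enum_rank x) (enum_rank y)) => [xy|yx|/val_inj/enum_rank_inj //].
- by have := le_lt_trans (le_trans (le_cumul xy) y1) x2; rewrite ltxx.
- by have := le_lt_trans (le_trans (le_cumul yx) x1) y2; rewrite ltxx.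
Qed.

End cumulative_weights.

(** [q h] is the intended probability of the infinite words with prefix [h], and [q_sum] is
    Kolmogorov consistency. The letter [x0] is a default for points without a code. *)
Variables (x0 : T) (q : seq T -> R).
Hypothesis q_nil : q [::] = 1.
Hypothesis q_ge0 : forall h, 0 <= q h.
Hypothesis q_sum : forall h, \sum_x q (rcons h x) = q h.

(* The points whose code starts with h form the interval of length q h with this
   left end. *)
Fixpoint left_end_rev (h : seq T) : R :=
  if h is x :: h' then
    left_end_rev h' + cumul (fun y => q (rcons (rev h') y)) (enum_rank x)
  else 0.

Definition left_end (h : seq T) : R := left_end_rev (rev h).

Lemma left_end_rcons h x :
  left_end (rcons h x) =
  left_end h + cumul (fun y => q (rcons h y)) (enum_rank x).
Proof. by rewrite /left_end rev_rcons /= revK. Qed.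

Definition in_word (u : R) (h : seq T) : bool :=
  left_end h <= u < left_end h + q h.

Lemma in_word_rconsE u h x : in_word u (rcons h x) =
  (cumul (fun y => q (rcons h y)) (enum_rank x) <= u - left_end h <
   cumul (fun y => q (rcons h y)) (enum_rank x) + q (rcons h x)).
Proof.
by rewrite /in_word left_end_rcons lerBrDl ltrBlDl addrA.
Qed.

Lemma in_word_cover u h : in_word u h -> exists x, in_word u (rcons h x).
Proof.
move=> /andP[u1 u2].
have [|x ux] := @cumul_cover (fun y => q (rcons h y)) (u - left_end h).
  by rewrite q_sum subr_ge0 u1 ltrBlDl.
by exists x; rewrite in_word_rconsE.
Qed.

Lemma in_word_uniq u h x y :
  in_word u (rcons h x) -> in_word u (rcons h y) -> x = y.
Proof. by rewrite !in_word_rconsE; apply: cumul_disjoint. Qed.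

Lemma in_word_rcons u h x : in_word u (rcons h x) -> in_word u h.
Proof.
rewrite in_word_rconsE => /andP[u1 u2]; apply/andP; split.
  by rewrite -subr_ge0 (le_trans _ u1)// cumul_ge0.
rewrite -ltrBlDl (lt_le_trans u2)// -(@cumulS (fun y => q (rcons h y))) -q_sum.
by rewrite -(cumul_total (fun y => q (rcons h y))) le_cumul.
Qed.

(** If [u] lies in the interval of [h], exactly one letter qualifies, because the children tile that
    interval; otherwise none does and [x0] is returned. *)
Definition code_next (u : R) (h : seq T) : T :=
  odflt x0 [pick x | in_word u (rcons h x)].

Fixpoint code_prefix (u : R) (n : nat) : seq T :=
  if n is n'.+1 then
    rcons (code_prefix u n') (code_next u (code_prefix u n'))
  else [::].

Definition code (u : R) (n : nat) : T := code_next u (code_prefix u n).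

Lemma mkseq_code u n : mkseq (code u) n = code_prefix u n.
Proof. by elim: n => //= n IH; rewrite mkseqS IH. Qed.

Lemma in_code_prefix u n : in_word u [::] -> in_word u (code_prefix u n).
Proof.
move=> u0; elim: n => //= n IH; rewrite /code_next.
case: pickP => //= /(_ _)/negbT none.
by have [x] := in_word_cover IH; rewrite (negbTE (none x)).
Qed.

Lemma code_prefixP u h : in_word u [::] ->
  code_prefix u (size h) = h <-> in_word u h.
Proof.
move=> u0; split=> [<-|]; first exact: in_code_prefix.
elim/last_ind: h => //= h x IH uhx; rewrite size_rcons /=.
rewrite IH; last exact: in_word_rcons uhx.
congr rcons; rewrite /code_next; case: pickP => [y /= uhy|/(_ x)].
  exact: in_word_uniq uhy uhx.
by rewrite uhx.
Qed.

Lemma in_word_itv u h :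
  in_word u h = (u \in `[left_end h, left_end h + q h[%R).
Proof. by rewrite in_itv. Qed.

Lemma in_word_nil u : in_word u [::] = (u \in `[0, 1[%R).
Proof. by rewrite in_word_itv q_nil /left_end /= add0r. Qed.

Definition word_event (h : seq T) : set (nat -> T) :=
  [set pi | mkseq pi (size h) = h].

(** The intersection with [[0, 1[] discards the points coded by the constant word [x0], which may
    itself have prefix [h]. *)
Lemma code_preimage h :
  code @^-1` word_event h `&` `[0, 1[ =
  [set` `[left_end h, left_end h + q h[%R].
Proof.
apply/seteqP; split => u; rewrite /word_event /=.
  rewrite mkseq_code -in_word_nil -in_word_itv => -[+ u0].
  by rewrite code_prefixP.
rewrite mkseq_code -in_word_nil -in_word_itv => uh.
suff u0 : in_word u [::] by rewrite code_prefixP.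
by elim/last_ind: h uh => // h x IH /in_word_rcons.
Qed.

Lemma code_out u : u \notin `[0, 1[%R -> code u = fun=> x0.
Proof.
move=> u0; apply/funext => n; rewrite /code /code_next.
case: pickP => // x ux; move: u0; rewrite -in_word_nil => /negP[].
move: (rcons _ x) ux => h; elim/last_ind: h => // h y IH /in_word_rcons.
exact: IH.
Qed.

(** On [[0, 1[] the preimage is an interval; on the complement the code is constant, so either all
    of the complement belongs to the preimage or none of it. *)
Lemma measurable_code_preimage h :
  measurable (code @^-1` word_event h : set (measurableTypeR R)).
Proof.
have -> : code @^-1` word_event h =
    [set` `[left_end h, left_end h + q h[%R] `|`
    (~` `[0, 1[ `&` [set _ | word_event h (fun=> x0)]).
  rewrite -code_preimage; apply/seteqP; split => u /=.
    have [u01|u01] := boolP (u \in `[0, 1[%R); first by left.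
    rewrite code_out // => hx; right; split => //; apply/negP.
  by move=> [[]//|[/negP u01]]; rewrite code_out.
apply: measurableU; first exact: measurable_itv.
apply: measurableI; first by apply: measurableC; exact: measurable_itv.
have [hx|hx] := pselect (word_event h (fun=> x0)).
  by rewrite (_ : [set _ | _] = setT) //; apply/seteqP; split.
by rewrite (_ : [set _ | _] = set0) //; apply/seteqP; split.
Qed.

End interval_coding.

Section unit_interval_probability.
Local Open Scope classical_set_scope.
Context {R : realType}.

Definition unit_interval_prob : set (measurableTypeR R) -> \bar R :=
  mrestr lebesgue_measure (measurable_itv `[0%R, 1%R[%R).

HB.instance Definition _ := Measure.on unit_interval_prob.

Lemma unit_interval_prob_setT : unit_interval_prob setT = 1%E.
Proof.
rewrite /unit_interval_prob /mrestr setTI lebesgue_measure_itv /=.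
by rewrite lte_fin ltr01 oppr0 adde0.
Qed.

HB.instance Definition _ := Measure_isProbability.Build _ _ _
  unit_interval_prob unit_interval_prob_setT.

End unit_interval_probability.

(** * Existence of the path measure *)

Section path_probability.
Context {R : realType} {S Act : finType} (M : mdp R S Act).
Variable sigma : @strategy R S Act.

(** The recursion runs over the reversed history, so that its head is the last step and its tail is
    the history that the strategy saw before that step. *)
Fixpoint path_prob_rev (h : seq (S * Act)) (t : S) : R :=
  if h is x :: h' then
    path_prob_rev h' x.1 * (sigma (rev h') x.1 x.2 * trans M x.1 x.2 t)
  else (t == init M)%:R.

Definition path_prob (h : seq (S * Act)) (t : S) : R := path_prob_rev (rev h) t.

Lemma path_prob_nil t : path_prob [::] t = (t == init M)%:R.
Proof. by []. Qed.

Lemma path_prob_rcons h x t : path_prob (rcons h x) t =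
  path_prob h x.1 * (sigma h x.1 x.2 * trans M x.1 x.2 t).
Proof. by rewrite /path_prob rev_rcons /= revK. Qed.

Lemma cylinder_probE n (w : run M) :
  cylinder_prob sigma n w = path_prob (mkseq w n) (w n).1.
Proof.
elim: n => [|n IH]; first by rewrite /cylinder_prob big_ord0 mulr1.
rewrite /cylinder_prob big_ord_recr/= mulrA -/(cylinder_prob _ _ _) IH.
by rewrite mkseqS path_prob_rcons.
Qed.

Hypothesis sigmaP : is_strategy M sigma.

Lemma trans_ge0 s a s' : 0 <= trans M s a s'.
Proof. by case/andP: (trans_01 M s a s'). Qed.

Lemma trans_enabled_sum s a : enabled M s a -> \sum_s' trans M s a s' = 1.
Proof.
case/existsP => s' ps'; case: (trans_sum M s a) => // sum0.
have /psumr_eq0P := sum0 => /(_ (fun i _ => trans_ge0 s a i)) /(_ s' isT) p0.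
by rewrite p0 ltxx in ps'.
Qed.

Lemma strategy_ge0 h s a : 0 <= sigma h s a.
Proof. by case: (sigmaP h s). Qed.

Lemma strategy_sum h s : \sum_a sigma h s a = 1.
Proof. by case: (sigmaP h s). Qed.

(** The transitions of a disabled action may sum to 0, but the strategy gives such an action weight
    0. *)
Lemma strategy_trans_sum h s a :
  \sum_s' sigma h s a * trans M s a s' = sigma h s a.
Proof.
rewrite -mulr_sumr; have [->|sa] := eqVneq (sigma h s a) 0.
  by rewrite mul0r.
by case: (sigmaP h s) => _ _ /(_ a sa)/trans_enabled_sum ->; rewrite mulr1.
Qed.

Lemma path_prob_ge0 h t : 0 <= path_prob h t.
Proof.
elim/last_ind: h t => [|h x IH] t; first by rewrite path_prob_nil ler0n.
by rewrite path_prob_rcons !mulr_ge0 ?strategy_ge0 ?trans_ge0.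
Qed.

(** Summing out the state reached after the last action leaves the probability of the state-action
    word [h]; this family plays the role of [q] in the coding. *)
Definition word_prob h : R := \sum_t path_prob h t.

Lemma word_prob_ge0 h : 0 <= word_prob h.
Proof. by apply: sumr_ge0 => t _; apply: path_prob_ge0. Qed.

Lemma word_prob_nil : word_prob [::] = 1.
Proof.
rewrite /word_prob (bigD1 (init M)) //= path_prob_nil eqxx big1 ?addr0 // => t.
by rewrite path_prob_nil => /negbTE ->.
Qed.

Lemma word_prob_rcons h x :
  word_prob (rcons h x) = path_prob h x.1 * sigma h x.1 x.2.
Proof.
rewrite /word_prob; under eq_bigr do rewrite path_prob_rcons.
by rewrite -mulr_sumr strategy_trans_sum.
Qed.

Lemma word_prob_last_sum h t :
  \sum_a word_prob (rcons h (t, a)) = path_prob h t.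
Proof.
under eq_bigr do rewrite word_prob_rcons /=.
by rewrite -mulr_sumr strategy_sum mulr1.
Qed.

Lemma word_prob_sum h : \sum_x word_prob (rcons h x) = word_prob h.
Proof.
under eq_bigr do rewrite word_prob_rcons.
rewrite -(pair_bigA _ (fun t a => path_prob h t * sigma h t a)) /=.
by apply: eq_bigr => t _; rewrite -mulr_sumr strategy_sum mulr1.
Qed.

Local Open Scope classical_set_scope.

(** A cylinder fixes the state at position [n] but not the action taken there, so it is a finite
    union of word events, one for each action. *)
Lemma cylinderE n (w : run M) : cylinder n w =
  \bigcup_(a in [set` enum Act]) word_event (rcons (mkseq w n) ((w n).1, a)).
Proof.
apply/seteqP; split => pi.
  move=> [eqw eqn]; exists (pi n).2; first by rewrite /= mem_enum.
  rewrite /word_event /= size_rcons size_mkseq mkseqS -eqn -surjective_pairing.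
  congr rcons; apply: (@eq_from_nth _ (w 0)) => [|i];
    rewrite !size_mkseq // => ni.
  by rewrite !nth_mkseq // eqw.
move=> [a _]; rewrite /word_event /= size_rcons size_mkseq mkseqS.
move=> /rcons_inj[e en]; split => [i ni|]; last by rewrite en.
by have := congr1 (fun s => nth (w 0%N) s i) e; rewrite !nth_mkseq.
Qed.

Lemma path_measure_exists : exists mu : probability (runs M) R,
  forall n (w : run M), mu (cylinder n w) = (cylinder_prob sigma n w)%:E.
Proof.
pose x0 : S * Act := (init M, xchoose (trans_enabled M (init M))).
pose f : measurableTypeR R -> runs M := code x0 word_prob.
have mcyl n w : f @^-1` cylinder n w =
    \bigcup_(a in [set` enum Act])
      (f @^-1` word_event (rcons (mkseq w n) ((w n).1, a))).
  by rewrite cylinderE preimage_bigcup.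
have mword h : measurable (f @^-1` word_event h).
  apply: measurable_code_preimage.
  - exact: word_prob_nil.
  - exact: word_prob_ge0.
  - exact: word_prob_sum.
have mf : measurable_fun [set: measurableTypeR R] f.
  apply: (@measurability _ _ _ (runs M) _ f (@cylinders R S Act M) erefl).
  move=> _ [_ [n [w ->]] <-]; rewrite setTI mcyl.
  by apply: fin_bigcup_measurable => // a _; apply: mword.
pose X : {mfun measurableTypeR R >-> runs M} := mfun_Sub (mem_set mf).
exists (distribution unit_interval_prob X) => n w.
rewrite -[LHS]/(unit_interval_prob (f @^-1` cylinder n w)) mcyl.
(* The word events of different actions differ in their last letter, hence are disjoint; their
   interval lengths add up to [path_prob] by [word_prob_last_sum]. *)
rewrite measure_fin_bigcup //=; last first.
  move=> a b _ _ [u []]; rewrite /word_event /= !size_rcons !size_mkseq => ->.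
  by move=> /rcons_inj[].
rewrite -fsbig_seq ?enum_uniq // big_enum /=.
rewrite cylinder_probE -word_prob_last_sum -sumEFin; apply: eq_bigr => a _.
rewrite /unit_interval_prob /= /mrestr code_preimage ?lebesgue_measure_itv /=.
- rewrite lte_fin ltrDl; case: ifPn => [_|].
    by rewrite -EFinB addrAC subrr add0r.
  by rewrite -leNgt => le0; congr EFin; apply/le_anti; rewrite word_prob_ge0 le0.
- exact: word_prob_nil.
- exact: word_prob_ge0.
- exact: word_prob_sum.
Qed.

End path_probability.

(** * Expected rewards *)

Section words.
Context {T : finType}.

Fixpoint words (n : nat) : seq (seq T) :=
  if n is n'.+1 then [seq rcons h x | h <- words n', x <- enum T] else [:: [::]].

Lemma big_wordsS {V : nmodType} n (F : seq T -> V) :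
  \sum_(h <- words n.+1) F h = \sum_(h <- words n) \sum_x F (rcons h x).
Proof.
rewrite /= big_flatten big_map; apply: eq_bigr => h _.
by rewrite big_map big_enum.
Qed.

Lemma size_words n h : h \in words n -> size h = n.
Proof.
elim: n h => [|n IH] h; first by rewrite inE => /eqP ->.
by move=> /allpairsP[[h' x] /= [/IH <- _ ->]]; rewrite size_rcons.
Qed.

(** Only the actual prefix of [pi] contributes. This writes a function of the prefix as a finite
    combination of indicators, ready for integration. *)
Lemma sum_words_mkseq {R : pzRingType} (pi : nat -> T) n (g : seq T -> R) :
  \sum_(h <- words n) g h * (mkseq pi n == h)%:R = g (mkseq pi n).
Proof.
elim: n g => [|n IH] g; first by rewrite big_seq1 eqxx mulr1.
rewrite big_wordsS mkseqS -(IH (fun h => g (rcons h (pi n)))).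
apply: eq_bigr => h _; rewrite (bigD1 (pi n)) //= big1 => [|x xpi].
  by rewrite addr0 eqseq_rcons eqxx andbT.
by rewrite eqseq_rcons [pi n == x]eq_sym (negbTE xpi) andbF mulr0.
Qed.

End words.

Section expected_reward.
Context {R : realType} {S Act : finType} (M : mdp R S Act).
Variable sigma : @strategy R S Act.
Hypothesis sigmaP : is_strategy M sigma.
Local Open Scope classical_set_scope.

Definition path_event (h : seq (S * Act)) (t : S) : set (runs M) :=
  [set pi | mkseq pi (size h) = h /\ (pi (size h)).1 = t].

(** Cylinders are indexed by infinite runs, so a finite path is padded to one; the padding matters
    only through its state [t] at position [size h]. *)
Definition path_extension (h : seq (S * Act)) (t : S) : run M :=
  nth (t, xchoose (trans_enabled M t)) h.

Lemma mkseq_path_extension h t : mkseq (path_extension h t) (size h) = h.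
Proof. exact: mkseq_nth. Qed.

Lemma path_extension_last h t : (path_extension h t (size h)).1 = t.
Proof. by rewrite /path_extension nth_default. Qed.

Lemma path_eventE h t :
  path_event h t = cylinder (size h) (path_extension h t).
Proof.
apply/seteqP; split => pi [] /=.
  move=> e <-; split; last by rewrite path_extension_last.
  move=> i ih; rewrite -[in RHS]e /path_extension nth_mkseq //.
move=> e; rewrite path_extension_last => <-; split => //.
rewrite -[RHS](mkseq_path_extension h t).
apply: (@eq_from_nth _ (pi 0%N)) => [|i]; rewrite !size_mkseq // => ih.
by rewrite !nth_mkseq // e.
Qed.

Lemma measurable_path_event h t : measurable (path_event h t).
Proof.
rewrite path_eventE; apply: sub_sigma_algebra.
by exists (size h), (path_extension h t).
Qed.

(** [path_measure] is a choice from the measures with the right cylinder values; as such a measure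
    exists, the chosen one has these values. *)
Lemma path_measureP n (w : run M) :
  path_measure M sigma (cylinder n w) = (cylinder_prob sigma n w)%:E.
Proof.
have [mu muP] := path_measure_exists sigmaP.
by have := @getPex _ [set mu : probability (runs M) R | forall n (w : run M),
  mu (cylinder n w) = (cylinder_prob sigma n w)%:E] (ex_intro _ mu muP).
Qed.

Lemma path_measure_event h t :
  path_measure M sigma (path_event h t) = (path_prob M sigma h t)%:E.
Proof.
by rewrite path_eventE path_measureP cylinder_probE mkseq_path_extension
  path_extension_last.
Qed.

Section finite_horizon.
Variables (n : nat) (g : seq (S * Act) -> S -> R).
Hypothesis g_ge0 : forall h t, 0 <= g h t.

(** A function of the first [n] steps and the next state is a simple function over path events. Its
    measurability and its integral both follow from this form. *)
Lemma finite_horizonE (pi : runs M) : (g (mkseq pi n) (pi n).1)%:E =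
  (\sum_(h <- words n) \sum_t (g h t)%:E * (\1_(path_event h t) pi)%:E)%E.
Proof.
rewrite -(sum_words_mkseq pi n (fun h => g h (pi n).1)) -sumEFin.
rewrite big_seq [RHS]big_seq; apply: eq_bigr => h /size_words hn.
rewrite (bigD1 (pi n).1) //= big1 ?adde0 => [|t tpi].
  rewrite indicE -EFinM; congr (_ * _)%:E; congr (nat_of_bool _)%:R.
  by apply/eqP/idP => [e|]; [apply/mem_set|move/set_mem];
    rewrite /path_event /= hn => // -[].
rewrite -EFinM indicE memNset ?mulr0 // /path_event /= hn => -[_ e].
by rewrite e eqxx in tpi.
Qed.

Lemma measurable_finite_horizon :
  measurable_fun [set: runs M]
    ((fun pi => (g (mkseq pi n) (pi n).1)%:E) : runs M -> \bar R).
Proof.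
under eq_fun do rewrite finite_horizonE.
apply: emeasurable_sum => h; apply: emeasurable_sum => t.
under eq_fun do rewrite -EFinM.
apply/measurable_EFinP; apply: measurable_funM => //.
apply: measurable_indic; exact: measurable_path_event.
Qed.

Lemma integral_finite_horizon :
  (\int[path_measure M sigma]_pi (g (mkseq pi n) (pi n).1)%:E =
  (\sum_(h <- words n) \sum_t g h t * path_prob M sigma h t)%:E)%E.
Proof.
under eq_integral do rewrite finite_horizonE.
have mg h t : measurable_fun [set: runs M]
    ((fun pi => (g h t)%:E * (\1_(path_event h t) pi)%:E)%E : runs M -> \bar R).
  under eq_fun do rewrite -EFinM.
  apply/measurable_EFinP; apply: measurable_funM => //.
  apply: measurable_indic; exact: measurable_path_event.
have g0 h t pi : (0 <= (g h t)%:E * (\1_(path_event h t) pi)%:E :> \bar R)%E.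
  by rewrite mule_ge0 ?lee_fin.
rewrite ge0_integral_sum //=; last 2 first.
- by move=> h; apply: emeasurable_sum.
- by move=> h pi _; apply: sume_ge0.
rewrite -sumEFin; apply: eq_bigr => h _.
rewrite ge0_integral_sum //= -sumEFin; apply: eq_bigr => t _.
rewrite ge0_integralZl //=; last 2 first.
- by apply/measurable_EFinP/measurable_indic; exact: measurable_path_event.
- by rewrite lee_fin.
rewrite integral_indic //; last exact: measurable_path_event.
rewrite setIT EFinM; congr (_ * _)%E; exact: path_measure_event.
Qed.

End finite_horizon.

Variables (rew : reward R S Act) (G : {set S}).

Definition avoids (h : seq (S * Act)) : bool := all (fun x => x.1 \notin G) h.

(** The prefix of length [i.+1] includes the state at position [i], so step [i] counts exactly when
    [i] is below the first hitting time of [G]. Both cases of [reward_until] thereby become one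
    series. *)
Definition reward_before (pi : run M) (i : nat) : R :=
  (avoids (mkseq pi i.+1))%:R * step_reward rew pi i.

Lemma reward_untilE (pi : run M) :
  reward_until rew G pi = (\sum_(0 <= i <oo) (reward_before pi i)%:E)%E.
Proof.
rewrite /reward_until; case: pselect => [hit|nohit].
  case: ex_minnP => m mG minm.
  have before i : avoids (mkseq pi i.+1) = (i < m)%N.
    apply/idP/idP => [/allP av|im].
      rewrite ltnNge; apply/negP => mi.
      have /av : pi m \in mkseq pi i.+1 by apply: map_f; rewrite mem_iota ltnS.
      by rewrite mG.
    apply/allP => _ /mapP[k + ->]; rewrite mem_iota add0n ltnS => ki.
    by apply/negP => /minm; rewrite leqNgt (leq_ltn_trans ki im).
  rewrite (nneseries_split 0 m) /=; last first.
    by move=> k _; rewrite lee_fin mulr_ge0 ?ler0n ?reward_ge0.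
  rewrite add0n [X in (_ + X)%E]eseries0 ?adde0 => [|i mi _]; last first.
    by rewrite /reward_before before ltnNge mi mul0r.
  rewrite big_mkord -sumEFin; apply: eq_bigr => i _.
  by rewrite /reward_before before ltn_ord mul1r.
apply: eq_eseriesr => i _; rewrite /reward_before (_ : avoids _) ?mul1r //.
by apply/allP => _ /mapP[k _ ->]; apply/negP => kG; apply: nohit; exists k.
Qed.

Definition step_weight (i : nat) : R :=
  \sum_(h <- words i) \sum_t \sum_a \sum_s
    (avoids (rcons h (t, a)))%:R * rew t a s *
    (path_prob M sigma h t * (sigma h t a * trans M t a s)).

Lemma expected_rewardE :
  expected_reward M sigma rew G = (\sum_(0 <= i <oo) (step_weight i)%:E)%E.
Proof.
rewrite /expected_reward; under eq_integral do rewrite reward_untilE.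
(* [x0] is only the default of [last]: the histories that occur have length [i.+1] and are
   nonempty. *)
pose x0 : S * Act := (init M, xchoose (trans_enabled M (init M))).
pose g (h : seq (S * Act)) (t : S) : R :=
  (avoids h)%:R * rew (last x0 h).1 (last x0 h).2 t.
have g_ge0 h t : 0 <= g h t by rewrite mulr_ge0 ?ler0n ?reward_ge0.
have gE i (pi : run M) : reward_before pi i = g (mkseq pi i.+1) (pi i.+1).1.
  by rewrite /reward_before /g mkseqS last_rcons.
(* Monotone convergence: the terms are nonnegative, and each depends on finitely many steps. *)
rewrite integral_nneseries //=; last 2 first.
- by move=> i; under eq_fun do rewrite gE; apply: measurable_finite_horizon.
- by move=> i pi _; rewrite gE lee_fin.
apply: eq_eseriesr => i _; under eq_integral do rewrite gE.
rewrite integral_finite_horizon // big_wordsS; congr EFin; apply: eq_bigr => h _.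
rewrite (pair_bigA _ (fun t a => \sum_s
    (avoids (rcons h (t, a)))%:R * rew t a s *
    (path_prob M sigma h t * (sigma h t a * trans M t a s)))) /=.
apply: eq_bigr => -[t a] _; apply: eq_bigr => s _.
by rewrite path_prob_rcons /g last_rcons.
Qed.

End expected_reward.

Lemma psumr_gt0 (R : numDomainType) (I : finType) (F : I -> R) (i : I) :
  (forall j, 0 <= F j) -> 0 < F i -> 0 < \sum_j F j.
Proof.
by move=> F0 Fi; rewrite (bigD1 i) //= ltr_pwDl // sumr_ge0.
Qed.

Lemma nneseries_gt0 (R : realType) (u : nat -> R) (n : nat) :
  (forall i, 0 <= u i) -> 0 < u n -> (0 < \sum_(0 <= i <oo) (u i)%:E)%E.
Proof.
move=> u0 un; have : (0 < \sum_(0 <= i < n.+1) (u i)%:E)%E.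
  by rewrite sumEFin lte_fin big_nat_recr //= ltr_wpDl // sumr_ge0.
by move=> /lt_le_trans; apply; apply: nneseries_lim_ge => i _ _; rewrite lee_fin.
Qed.

(** * Memoryless randomized strategies and their state distributions *)

Section stationary.
Context {R : realType} {S Act : finType} (M : mdp R S Act).
Variable tau : S -> Act -> R.
Hypothesis tauP : is_strategy M (fun=> tau).

Fixpoint state_dist (n : nat) (t : S) : R :=
  if n is n'.+1 then
    \sum_s \sum_a state_dist n' s * (tau s a * trans M s a t)
  else (t == init M)%:R.

(** Since [tau] ignores the history, all histories of one length that end in the same state can be
    lumped together. *)
Lemma sum_path_prob n t :
  \sum_(h <- words n) path_prob M (fun=> tau) h t = state_dist n t.
Proof.
elim: n t => [|n IH] t; first by rewrite big_seq1.
rewrite big_wordsS exchange_big /=.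
rewrite (pair_bigA _ (fun s a => state_dist n s * (tau s a * trans M s a t))) /=.
apply: eq_bigr => -[s a] _; rewrite -IH mulr_suml; apply: eq_bigr => h _.
by rewrite path_prob_rcons.
Qed.

Lemma state_dist_ge0 n t : 0 <= state_dist n t.
Proof.
by rewrite -sum_path_prob sumr_ge0 // => h _; apply: path_prob_ge0.
Qed.

Lemma expected_total_stationary (rew : reward R S Act) :
  expected_reward M (fun=> tau) rew finset.set0 =
  (\sum_(0 <= i <oo) (\sum_t \sum_a \sum_s
     rew t a s * (state_dist i t * (tau t a * trans M t a s)))%:E)%E.
Proof.
rewrite expected_rewardE //; apply: eq_eseriesr => i _; congr EFin.
rewrite /step_weight exchange_big /=; apply: eq_bigr => t _.
rewrite exchange_big /=; apply: eq_bigr => a _.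
rewrite exchange_big /=; apply: eq_bigr => s _.
rewrite -sum_path_prob mulr_suml mulr_sumr; apply: eq_bigr => h _.
rewrite (_ : avoids _ _) ?mul1r //.
by apply/allP => x _; rewrite inE.
Qed.

End stationary.

(** * States without reachable reward *)

Section zero_states.
Context {R : realType} {S Act : finType} (M : mdp R S Act).

Lemma trans_gt0_enabled s a t : 0 < trans M s a t -> enabled M s a.
Proof. by move=> pt; apply/existsP; exists t. Qed.

Definition mdp_edge : rel S := fun s t => [exists a, 0 < trans M s a t].

Lemma path_prob_connect (sigma : @strategy R S Act) h t :
  path_prob M sigma h t != 0 -> connect mdp_edge (init M) t.
Proof.
elim/last_ind: h t => [|h x IH] t.
  by rewrite path_prob_nil pnatr_eq0 eqb0 negbK => /eqP ->.
rewrite path_prob_rcons !mulf_eq0 !negb_or => /and3P[/IH hx _ px].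
apply: (connect_trans hx); apply: connect1; apply/existsP; exists x.2.
by rewrite lt_def px trans_ge0.
Qed.

(** A strategy that gives every enabled action positive weight reaches every graph-reachable state
    with positive probability, so it alone detects all reachable rewards. *)
Definition uniform_choice (s : S) (a : Act) : R :=
  (enabled M s a)%:R / #|[pred b | enabled M s b]|%:R.

Lemma card_enabled_gt0 s : (0 < #|[pred b | enabled M s b]|)%N.
Proof.
by have [a sa] := trans_enabled M s; apply/card_gt0P; exists a; rewrite inE.
Qed.

Lemma uniform_choice_gt0 s a : enabled M s a -> 0 < uniform_choice s a.
Proof.
by move=> sa; rewrite /uniform_choice sa mul1r invr_gt0 ltr0n card_enabled_gt0.
Qed.

Lemma uniform_choiceP : is_strategy M (fun=> uniform_choice).
Proof.
move=> h s; split=> [a||a].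
- by rewrite mulr_ge0 ?invr_ge0 ?ler0n.
- rewrite -mulr_suml -natr_sum -big_mkcond sum1_card divff //.
  by rewrite pnatr_eq0 -lt0n card_enabled_gt0.
- by rewrite mulf_eq0 negb_or pnatr_eq0 eqb0 negbK => /andP[].
Qed.

Lemma uniform_state_dist_gt0 t : connect mdp_edge (init M) t ->
  exists n, 0 < state_dist M uniform_choice n t.
Proof.
case/connectP => p; elim/last_ind: p t => [|p x IH] t /=.
  by move=> _ ->; exists 0%N; rewrite /= eqxx ltr01.
rewrite rcons_path last_rcons => /andP[pp /existsP[a pa]] ->.
have [n dn] := IH _ pp erefl; exists n.+1 => /=.
have ge0 s b : 0 <= state_dist M uniform_choice n s *
    (uniform_choice s b * trans M s b x).
  rewrite !mulr_ge0 ?trans_ge0 ?(strategy_ge0 uniform_choiceP [::]) //.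
  exact/state_dist_ge0/uniform_choiceP.
apply: (psumr_gt0 (i := last (init M) p)) => [s|]; first exact: sumr_ge0.
apply: (psumr_gt0 (i := a)) => //.
rewrite mulr_gt0 // mulr_gt0 //; exact/uniform_choice_gt0/trans_gt0_enabled/pa.
Qed.

End zero_states.

Section zero_states_connect.
Context {R : realType} {S Act : finType} (M : mdp R S Act).

(** A reachable transition with positive reward makes one term of the series of the uniform strategy
    positive. Conversely, under any strategy a history of nonzero probability ends in a reachable
    state, so every term vanishes. *)
Lemma zero_statesP (rew : reward R S Act) s :
  s \in zero_states M rew <->
  (forall t a t', connect (mdp_edge M) s t -> 0 < trans M t a t' ->
     rew t a t' = 0).
Proof.
rewrite inE; split=> [/asboolP zs t a t' st pt|zs].
  have [n dn] := @uniform_state_dist_gt0 _ _ _ (mdp_at M s) t st.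
  have := zs _ (uniform_choiceP M).
  have uP := uniform_choiceP (mdp_at M s).
  rewrite (@expected_total_stationary _ _ _ (mdp_at M s) _ uP) => E0.
  apply/eqP; rewrite eq_le reward_ge0 andbT leNgt; apply/negP => rgt0.
  move: E0 => /eqP; apply/negP; rewrite gt_eqF //.
  have ge0 i t1 b s' : 0 <= rew t1 b s' *
      (state_dist (mdp_at M s) (uniform_choice M) i t1 *
       (uniform_choice M t1 b * trans M t1 b s')).
    rewrite !mulr_ge0 ?reward_ge0 ?trans_ge0 ?(strategy_ge0 uP [::]) //.
    exact: state_dist_ge0.
  apply: (@nneseries_gt0 _ _ n) => [i|].
    by do 3! apply: sumr_ge0 => ? _.
  apply: (psumr_gt0 (i := t)) => [?|]; first by do 2! apply: sumr_ge0 => ? _.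
  apply: (psumr_gt0 (i := a)) => [?|]; first exact: sumr_ge0.
  apply: (psumr_gt0 (i := t')) => //.
  rewrite mulr_gt0 // mulr_gt0 // mulr_gt0 //.
  exact/uniform_choice_gt0/trans_gt0_enabled/pt.
apply/asboolP => sigma sigmaP.
rewrite (@expected_rewardE _ _ _ (mdp_at M s)) //.
apply: eseries0 => i _ _; congr EFin; rewrite /step_weight.
apply: big1 => h _; apply: big1 => t _; apply: big1 => a _; apply: big1 => t' _.
have [->|/path_prob_connect st] := eqVneq (path_prob (mdp_at M s) sigma h t) 0.
  by rewrite mul0r mulr0.
have [->|pt] := eqVneq (trans (mdp_at M s) t a t') 0; first by rewrite !mulr0.
by rewrite (zs t a t' st) ?mulr0 ?mul0r // lt_def pt trans_ge0.
Qed.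

Variables (l : nat) (Q : 'I_l -> objective R S Act).

Lemma S_zero_closed s a t : s \in S_zero M Q -> 0 < trans M s a t ->
  t \in S_zero M Q.
Proof.
move=> /bigcapP s0 pst; apply/bigcapP => j _; have /zero_statesP zs := s0 j isT.
apply/zero_statesP => t1 b t2 ct1; apply: zs; apply: connect_trans ct1.
by apply: connect1; apply/existsP; exists a.
Qed.

Lemma S_zero_reward j s a t : s \in S_zero M Q -> 0 < trans M s a t ->
  obj_reward (Q j) s a t = 0.
Proof.
by move=> /bigcapP/(_ j isT)/zero_statesP zs; apply: zs; apply: connect0.
Qed.

(** [S_zero] cannot be left, so a possible history that ends outside has never been inside. *)
Lemma path_prob_avoids (sigma : @strategy R S Act) h t a :
  t \notin S_zero M Q -> path_prob M sigma h t != 0 ->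
  avoids (S_zero M Q) (rcons h (t, a)).
Proof.
elim/last_ind: h t a => [|h x IH] t a tS; first by rewrite /avoids /= tS.
rewrite path_prob_rcons !mulf_eq0 !negb_or => /and3P[hx _ px].
rewrite /avoids all_rcons /= tS /= [x]surjective_pairing; apply: IH => //.
apply: contra tS => xS; apply: (S_zero_closed (a := x.2) xS).
by rewrite lt_def px trans_ge0.
Qed.

End zero_states_connect.

(** * End components *)

Section bottom_component.
Context {R : realType} {S Act : finType} (M : mdp R S Act).

(** The end component is a bottom strongly connected component of the graph of [sigma], found as the
    reachable set of a state of [D] whose reachable set is smallest. *)
Lemma closed_has_end_component (sigma : S -> Act) (D : {set S}) (s0 : S) :
  pure_stationary M sigma -> s0 \in D ->
  (forall s t, s \in D -> 0 < trans M s (sigma s) t -> t \in D) ->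
  exists2 E, end_component M E & states_of E \subset D.
Proof.
move=> sigmaP s0D closedD.
pose e : rel S := fun s t => 0 < trans M s (sigma s) t.
have [s sD smin] := arg_minnP (fun s => #|connect e s|) s0D.
have connectD t : connect e s t -> t \in D.
  case/connectP => p; elim/last_ind: p t => [|p x IH] t /=; first by move=> _ ->.
  rewrite rcons_path last_rcons => /andP[pp ex] ->.
  exact: closedD (IH _ pp erefl) ex.
have back t : connect e s t -> connect e t s.
  (* What [t] reaches is contained in what [s] reaches; by minimality the two sets coincide, so [t]
     reaches [s]. *)
  move=> st; have sub : connect e t \subset connect e s.
    by apply/fintype.subsetP => u tu; apply: connect_trans st tu.
  rewrite -[_ t s]/(s \in connect e t).
  have /subset_cardP/(_ sub) -> : #|connect e t| = #|connect e s|.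
    by apply/eqP; rewrite eqn_leq subset_leq_card //=; exact/smin/connectD.
  exact: connect0.
pose E : {set S * Act} := [set x | connect e s x.1 && (x.2 == sigma x.1)]%SET.
have statesE t : (t \in states_of E) = connect e s t.
  rewrite inE; apply/existsP/idP => [[a]|st]; first by rewrite inE => /andP[].
  by exists (sigma t); rewrite inE /= st eqxx.
exists E; last by apply/fintype.subsetP => t; rewrite statesE => /connectD.
split.
- apply/finset.set0Pn; exists (s, sigma s); by rewrite inE /= connect0 eqxx.
- move=> t a; rewrite inE /= => /andP[st /eqP ->]; split=> // t' pt.
  by rewrite statesE; apply: connect_trans st (connect1 _).
- move=> t t'; rewrite !statesE => st st'.
  have /connectP[p] := connect_trans (back t st) st'.
  elim/last_ind: p t' {st'} => [|p x IH] t' /=; first by move=> _ ->.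
  rewrite rcons_path last_rcons => /andP[pp ex] ->.
  apply: connect_trans (IH _ pp erefl) (connect1 _).
  apply/existsP; exists (sigma (last t p)); rewrite inE /= eqxx andbT.
  by rewrite [0 < _]ex andbT; apply: connect_trans st _; apply/connectP; exists p.
Qed.

(** Each of the two closed sets contains the states of an end component, and by uniqueness it is the
    same one. *)
Lemma one_end_component_meet (sigma : S -> Act) (D1 D2 : {set S}) (s1 s2 : S) :
  (exists! E : {set S * Act}, end_component M E) -> pure_stationary M sigma ->
  s1 \in D1 -> (forall s t, s \in D1 -> 0 < trans M s (sigma s) t -> t \in D1) ->
  s2 \in D2 -> (forall s t, s \in D2 -> 0 < trans M s (sigma s) t -> t \in D2) ->
  exists2 s, s \in D1 & s \in D2.
Proof.
move=> [E [EC uniqE]] sigmaP s1D c1 s2D c2.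
have [E1 EC1 sub1] := closed_has_end_component sigmaP s1D c1.
have [E2 EC2 sub2] := closed_has_end_component sigmaP s2D c2.
have eqE : E1 = E2 by rewrite -(uniqE _ EC1) -(uniqE _ EC2).
have [/finset.set0Pn[[s a] sa] _ _] := EC1.
have sE : s \in states_of E1 by rewrite inE; apply/existsP; exists a.
exists s; first exact: (fintype.subsetP sub1).
by apply: (fintype.subsetP sub2); rewrite -eqE.
Qed.

End bottom_component.

(** * Flows and expected numbers of visits *)

Section expected_visits.
Context {R : realType} {S : finType} (A : S -> S -> R) (i0 : S) (D : {set S}).
Hypothesis A_ge0 : forall s t, 0 <= A s t.
Hypothesis A_closed : forall s t, s \notin D -> t \in D -> A s t = 0.

Fixpoint chain_dist (n : nat) (t : S) : R :=
  if n is n'.+1 then \sum_s chain_dist n' s * A s t else (t == i0)%:R.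

Lemma chain_dist_ge0 n t : 0 <= chain_dist n t.
Proof.
elim: n t => [|n IH] t /=; first exact: ler0n.
by apply: sumr_ge0 => s _; rewrite mulr_ge0.
Qed.

Lemma chain_distS n t : t \in D ->
  chain_dist n.+1 t = \sum_(s in D) chain_dist n s * A s t.
Proof.
move=> tD; rewrite /= (bigID (mem D)) /= [X in _ + X]big1 ?addr0 // => s sD.
by rewrite A_closed ?mulr0.
Qed.

Definition visits (s : S) : \bar R := (\sum_(0 <= n <oo) (chain_dist n s)%:E)%E.

Definition is_flow (z : S -> R) : Prop := forall s, s \in D ->
  z s = (s == i0)%:R + \sum_(t in D) z t * A t s.

(** Induction on the partial sums: inserting the bound for [N] terms into the right side of the flow
    equation gives the bound for one more term. *)
Lemma visits_le_flow (z : S -> R) : (forall s, s \in D -> 0 <= z s) ->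
  is_flow z -> forall s, s \in D -> (visits s <= (z s)%:E)%E.
Proof.
move=> z0 zflow s sD; apply: lime_le.
  by apply: is_cvg_nneseries => n _ _; rewrite lee_fin chain_dist_ge0.
apply: nearW => N; rewrite sumEFin lee_fin.
elim: N s sD => [|N IH] s sD; first by rewrite big_geq // z0.
(* The term of time 0 is the source term of the flow equation and cancels. *)
rewrite big_nat_recl // zflow // -[chain_dist 0 s]/((s == i0)%:R) lerD2l.
under eq_bigr do rewrite chain_distS //.
rewrite exchange_big /=; apply: ler_sum => t tD.
by rewrite -mulr_suml ler_wpM2r // IH.
Qed.

Hypothesis visits_fin : forall s, s \in D -> (visits s < +oo)%E.

(** Meaningful on [D], where the visits are finite; elsewhere they may be infinite, and [fine] then
    gives 0. *)
Definition occupation (s : S) : R := fine (visits s).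

Lemma visits_ge0 s : (0 <= visits s)%E.
Proof. by apply: nneseries_ge0 => n _ _; rewrite lee_fin chain_dist_ge0. Qed.

Lemma occupation_ge0 s : 0 <= occupation s.
Proof. exact/fine_ge0/visits_ge0. Qed.

Lemma occupationE s : s \in D -> (occupation s)%:E = visits s.
Proof. by move=> sD; rewrite fineK // ge0_fin_numE ?visits_ge0 ?visits_fin. Qed.

Lemma sum_occupation (c : S -> R) : (forall s, 0 <= c s) ->
  (\sum_(0 <= n <oo) (\sum_(s in D) chain_dist n s * c s)%:E =
   (\sum_(s in D) occupation s * c s)%:E)%E.
Proof.
move=> c0; under eq_eseriesr do rewrite -sumEFin.
rewrite nneseries_sum => [|s n _]; last by rewrite lee_fin mulr_ge0 ?chain_dist_ge0.
rewrite -sumEFin; apply: eq_bigr => s sD.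
rewrite EFinM occupationE // muleC -nneseriesZl => [|n _]; last first.
  by rewrite lee_fin chain_dist_ge0.
by apply: eq_eseriesr => n _; rewrite EFinM muleC.
Qed.

Lemma occupation_flow : is_flow occupation.
Proof.
move=> s sD; apply: EFin_inj.
rewrite occupationE // EFinD -(sum_occupation (c := A^~ s)) //.
rewrite /visits nneseries_recl //; last by move=> n _; rewrite lee_fin chain_dist_ge0.
congr (_ + _)%E; rewrite -nneseries_addn; last first.
  by move=> n; rewrite lee_fin chain_dist_ge0.
by apply: eq_eseriesr => n _; rewrite addn1 chain_distS.
Qed.

(** Sum the flow equations over [D]: the total mass is the injected unit plus the mass that stays in
    [D]. As the rows sum to 1, the mass that leaves [D] is that unit. *)
Lemma flow_absorption (z : S -> R) :
  (forall s, s \in D -> \sum_t A s t = 1) -> i0 \in D -> is_flow z ->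
  \sum_(s in D) z s * \sum_(t in ~: D) A s t = 1.
Proof.
move=> A1 i0D zflow.
have : \sum_(s in D) z s = 1 + \sum_(t in D) z t * \sum_(s in D) A t s.
  rewrite (eq_bigr _ zflow) big_split /= [X in X + _](bigD1 i0) //= eqxx.
  rewrite [X in _ + X + _]big1 ?addr0 => [|s /andP[_ /negbTE ->] //].
  by rewrite exchange_big /=; congr (_ + _); apply: eq_bigr => t _; rewrite mulr_sumr.
move/eqP; rewrite -subr_eq => /eqP <-; rewrite -sumrB; apply: eq_bigr => s sD.
rewrite -[X in X - _]mulr1 -mulrBr -(A1 s sD) [in RHS](bigID (mem D)) /=.
by rewrite addrAC subrr add0r; congr (_ * _); apply: eq_bigl => t; rewrite inE.
Qed.

(* The difference of two flows is an invariant measure: its support is closed,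
   and by the absorption equation it never leaves D. *)
Lemma flow_unique (z : S -> R) :
  (forall s, s \in D -> \sum_t A s t = 1) -> i0 \in D ->
  (forall s, s \in D -> 0 <= z s) -> is_flow z ->
  (forall B : {set S}, B \subset D ->
     (forall s t, s \in B -> 0 < A s t -> t \in B) -> B = finset.set0) ->
  forall s, s \in D -> z s = occupation s.
Proof.
move=> A1 i0D z0 zflow noB s sD; pose d t := z t - occupation t.
have d0 t : t \in D -> 0 <= d t.
  by move=> tD; rewrite subr_ge0 -lee_fin occupationE // visits_le_flow.
have dflow t : t \in D -> d t = \sum_(u in D) d u * A u t.
  move=> tD; rewrite /d zflow // occupation_flow // opprD addrACA subrr add0r.
  by rewrite -sumrB; apply: eq_bigr => u _; rewrite mulrBl.
have dabs t u : t \in D -> u \notin D -> d t * A t u = 0.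
  move=> tD uD.
  (* Both flows discharge exactly one unit out of [D], so the difference discharges nothing, and
     each of its nonnegative terms is 0. *)
  have : \sum_(s in D) d s * \sum_(t in ~: D) A s t = 0.
    under eq_bigr do rewrite mulrBl.
    by rewrite sumrB !flow_absorption ?subrr //; exact: occupation_flow.
  move=> /psumr_eq0P => /(_ (fun s sD => mulr_ge0 (d0 s sD) (sumr_ge0 _ _))).
  move=> /(_ (fun _ _ _ => A_ge0 _ _) t tD).
  rewrite mulr_sumr => /psumr_eq0P; apply.
  - by move=> ? _; rewrite mulr_ge0 ?d0.
  - by rewrite inE.
pose B := [set t in D | 0 < d t]%SET.
have B0 : B = finset.set0.
  apply: noB; first by apply/fintype.subsetP => t; rewrite inE => /andP[].
  move=> t u; rewrite inE => /andP[tD dt] ptu.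
  have uD : u \in D.
    apply/negPn/negP => /(dabs t u tD)/eqP.
    by rewrite mulf_eq0 !gt_eqF.
  (* The summand of [t] in the balance equation of [u] is already positive. *)
  rewrite inE uD dflow // (bigD1 t) //= ltr_pwDl ?mulr_gt0 //.
  rewrite sumr_ge0 // => v /andP[vD _].
  by rewrite mulr_ge0 ?d0.
apply/eqP; rewrite -subr_eq0 eq_le d0 // andbT leNgt; apply/negP => ds.
by have : s \in B; [rewrite inE sD|rewrite B0 inE].
Qed.

End expected_visits.

(** * Pure stationary strategies *)

Section pure_stationary.
Context {R : realType} {S Act : finType} (M : mdp R S Act) (l : nat).
Variables (Q : 'I_l -> objective R S Act) (sigma : S -> Act).
Hypothesis sigmaP : pure_stationary M sigma.

Lemma in_S_maybe s : (s \in S_maybe M Q) = (s \notin S_zero M Q).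
Proof. by rewrite inE. Qed.

Definition pure_choice (s : S) (a : Act) : R := (a == sigma s)%:R.

Definition pure_trans (s t : S) : R := trans M s (sigma s) t.

Definition pure_reward (j : 'I_l) (s : S) : R :=
  \sum_t trans M s (sigma s) t * obj_reward (Q j) s (sigma s) t.

Lemma sum_pure_choice s (F : Act -> R) :
  \sum_a pure_choice s a * F a = F (sigma s).
Proof.
rewrite (bigD1 (sigma s)) //= /pure_choice eqxx mul1r big1 ?addr0 // => a.
by move=> /negbTE ->; rewrite mul0r.
Qed.

Lemma strategy_of_psP : is_strategy M (strategy_of_ps sigma).
Proof.
move=> h s; split=> [a||a]; rewrite /strategy_of_ps ?ler0n //.
  by have := sum_pure_choice s (fun=> 1); under eq_bigr do rewrite mulr1.
by rewrite pnatr_eq0 eqb0 negbK => /eqP ->.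
Qed.

Lemma state_dist_pure n t :
  state_dist M pure_choice n t = chain_dist pure_trans (init M) n t.
Proof.
elim: n t => //= n IH t; apply: eq_bigr => s _.
by rewrite -mulr_sumr IH (sum_pure_choice s (fun a => trans M s a t)).
Qed.

Lemma pure_trans_ge0 s t : 0 <= pure_trans s t.
Proof. exact: trans_ge0. Qed.

Lemma pure_trans_sum s : \sum_t pure_trans s t = 1.
Proof. exact: trans_enabled_sum. Qed.

Lemma pure_trans_closed s t :
  s \notin S_maybe M Q -> t \in S_maybe M Q -> pure_trans s t = 0.
Proof.
rewrite !in_S_maybe negbK => s0 t0; apply/eqP/negPn/negP => pn0.
move: t0 => /negP; apply; apply: (S_zero_closed (a := sigma s) s0).
by rewrite lt_def pn0 trans_ge0.
Qed.

Lemma pure_reward_ge0 j s : 0 <= pure_reward j s.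
Proof. by apply: sumr_ge0 => t _; rewrite mulr_ge0 ?trans_ge0 ?reward_ge0. Qed.

Lemma pure_reward_eq0 j s : s \notin S_maybe M Q -> pure_reward j s = 0.
Proof.
rewrite in_S_maybe negbK => s0; apply: big1 => t _.
have [->|pn0] := eqVneq (trans M s (sigma s) t) 0; first by rewrite mul0r.
by rewrite (S_zero_reward _ s0) ?mulr0 // lt_def pn0 trans_ge0.
Qed.

(** Inside [S_zero] every possible transition has reward 0, so only the states with finitely many
    expected visits contribute. *)
Lemma expected_total_pure j :
  expected_reward M (strategy_of_ps sigma) (obj_reward (Q j)) finset.set0 =
  (\sum_(0 <= n <oo) (\sum_(s in S_maybe M Q)
     chain_dist pure_trans (init M) n s * pure_reward j s)%:E)%E.
Proof.
rewrite (@expected_total_stationary _ _ _ M pure_choice strategy_of_psP).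
apply: eq_eseriesr => n _; congr EFin.
rewrite [RHS]big_mkcond /=; apply: eq_bigr => s _.
transitivity (chain_dist pure_trans (init M) n s * pure_reward j s); last first.
  by case: ifPn => // /pure_reward_eq0 ->; rewrite mulr0.
rewrite -state_dist_pure /pure_reward -(sum_pure_choice s
  (fun a => \sum_t trans M s a t * obj_reward (Q j) s a t)) mulr_sumr.
apply: eq_bigr => a _.
rewrite !mulr_sumr; apply: eq_bigr => t _.
by rewrite mulrC -!mulrA.
Qed.

(** Stopping at [S_zero] loses no visit of [s], by [path_prob_avoids]. This connects the bounds [X]
    with the visits of the induced chain. *)
Lemma expected_visits_pure s : s \in S_maybe M Q ->
  expected_reward M (strategy_of_ps sigma) (visit_reward s (sigma s))
    (S_zero M Q) = visits pure_trans (init M) s.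
Proof.
rewrite in_S_maybe => s0; rewrite expected_rewardE; last exact: strategy_of_psP.
apply: eq_eseriesr => n _; congr EFin; rewrite -state_dist_pure -sum_path_prob.
apply: eq_bigr => h _; rewrite (bigD1 s) //= [X in _ + X]big1 => [|t ts].
  2: by do 2! (rewrite big1 // => ? _); rewrite (negbTE ts) mulr0 mul0r.
rewrite addr0 (bigD1 (sigma s)) //= [X in _ + X]big1 => [|a ta]; last first.
  by rewrite big1 // => t' _; rewrite (negbTE ta) andbF mulr0 mul0r.
rewrite addr0 !eqxx /=.
have [pp0|ppn0] := eqVneq (path_prob M (strategy_of_ps sigma) h s) 0.
  by rewrite pp0 big1 // => t _; rewrite mul0r mulr0.
rewrite (path_prob_avoids _ s0 ppn0) -mulr_sumr mul1r.
rewrite -mulr_sumr -mulr_sumr /strategy_of_ps eqxx.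
by rewrite trans_enabled_sum ?mulr1 // mul1r.
Qed.

Section supported.
Variable y : S -> Act -> R.
Hypothesis y_supp : forall s a, s \in S_maybe M Q -> enabled M s a ->
  a != sigma s -> y s a = 0.

Lemma sum_enabled_supported s (c : Act -> R) : s \in S_maybe M Q ->
  \sum_(a | enabled M s a) y s a * c a = y s (sigma s) * c (sigma s).
Proof.
move=> sQ; rewrite (bigD1 (sigma s)) ?sigmaP //= big1 ?addr0 // => a /andP[sa na].
by rewrite y_supp ?mul0r.
Qed.

Lemma inflow_supported s :
  \sum_(t : S * Act | (t.1 \in S_maybe M Q) && (0 < trans M t.1 t.2 s))
    trans M t.1 t.2 s * y t.1 t.2 =
  \sum_(t in S_maybe M Q) y t (sigma t) * pure_trans t s.
Proof.
rewrite -(pair_big_dep (mem (S_maybe M Q)) (fun t a => 0 < trans M t a s)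
  (fun t a => trans M t a s * y t a)) /=.
apply: eq_bigr => t tQ.
(* If [sigma t] cannot lead to [s], it is missing from the sum on the left, and its coefficient on
   the right is 0. *)
have [pt|pt] := boolP (0 < trans M t (sigma t) s).
  rewrite (bigD1 (sigma t)) //= big1 ?addr0 1?mulrC // => a /andP[pa na].
  by rewrite y_supp ?mulr0 //; apply: trans_gt0_enabled pa.
have -> : pure_trans t s = 0.
  by apply/eqP/negPn; apply: contra pt => pt; rewrite lt_def pt trans_ge0.
rewrite mulr0 big1 // => a pa; rewrite y_supp ?mulr0 //.
  exact: trans_gt0_enabled pa.
by apply: contraNneq pt => <-.
Qed.

End supported.

End pure_stationary.

(** * Solutions of the constraint system and achieving strategies *)

Lemma binary_choice_unique (R : numDomainType) (I : finType) (P : pred I)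
    (a : I -> R) :
  (forall i, P i -> a i = 0 \/ a i = 1) -> \sum_(i | P i) a i = 1 ->
  exists2 i, P i & forall k, P k -> k != i -> a k = 0.
Proof.
move=> a01 sum1; have a0 i : P i -> 0 <= a i by move=> /a01[] ->; rewrite ?ler01.
have [i /andP[Pi ai]|none] := pickP (fun i => P i && (a i == 1)).
  exists i => // k Pk ki; move: sum1; rewrite (bigD1 i) //= (eqP ai).
  rewrite -[RHS]addr0 => /addrI/psumr_eq0P; apply; last by rewrite Pk.
  by move=> k' /andP[/a0].
move: sum1; rewrite big1 => [/eqP|i Pi]; first by rewrite eq_sym oner_eq0.
have [//|ai] := a01 i Pi; by have := none i; rewrite Pi ai eqxx.
Qed.

Lemma compare_sem_EFin (R : realType) c (x y : R) :
  compare_sem c x%:E y%:E = compare_sem c x y.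
Proof. by case: c; rewrite /= lee_fin. Qed.

Theorem theorem3 (R : realType) (S Act : finType) (M : mdp R S Act) (l : nat)
    (Q : 'I_l -> objective R S Act) (p : 'rV[R]_l) (X : S -> rat)
    (Qtotal : forall j, obj_goal (Q j) = finset.set0)
    (one_ec : exists! E : {set S * Act}, end_component M E)
    (finite_reward : forall (j : 'I_l) (s : S) (sigma : S -> Act),
       pure_stationary M sigma ->
       (expected_reward (mdp_at M s) (strategy_of_ps sigma)
          (obj_reward (Q j)) finset.set0 < +oo)%E)
    (X_bound : forall s : S, s \in S_maybe M Q ->
       forall sigma : S -> Act, pure_stationary M sigma ->
       forall al : Act, enabled M s al ->
       (expected_reward M (strategy_of_ps sigma) (visit_reward s al)
          (S_zero M Q) <= (ratr (X s))%:E)%E)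
    (init_maybe : init M \in S_maybe M Q) :
  (exists (a y : S -> Act -> R) (x : 'rV[R]_l), C2 M Q p X a y x) <->
  Ach_PS M Q p.
Proof.
have visits_le sigma : pure_stationary M sigma -> forall s, s \in S_maybe M Q ->
    (visits (pure_trans M sigma) (init M) s <= (ratr (X s))%:E)%E.
  move=> sigmaP s sQ; rewrite -(expected_visits_pure sigmaP sQ).
  exact: X_bound.
have visits_fin sigma : pure_stationary M sigma -> forall s, s \in S_maybe M Q ->
    (visits (pure_trans M sigma) (init M) s < +oo)%E.
  by move=> sigmaP s sQ; apply: le_lt_trans (visits_le _ sigmaP _ sQ) (ltry _).
have maybeC : (~: S_maybe M Q)%SET = S_zero M Q by rewrite /S_maybe finset.setCK.
split.
  case=> a [y [x [aP yP flow absorb xP]]].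
  (* The 0/1 variables single out one enabled action in each state; the bounds [X_s a_{s,al}] then
     force [y] to vanish on all others. *)
  have /fin_all_exists2[sigma sigmaP a_supp] : forall s,
      exists2 al, enabled M s al &
        forall b, enabled M s b -> b != al -> a s b = 0.
    by move=> s; have [a01 a1] := aP s; apply: binary_choice_unique.
  have y_supp s b :
      s \in S_maybe M Q -> enabled M s b -> b != sigma s -> y s b = 0.
    move=> sQ sb nb; have := yP s b sQ sb; rewrite a_supp // mulr0 => yb.
    by apply/le_anti; rewrite andbC.
  pose z s := y s (sigma s).
  have z_ge0 s : s \in S_maybe M Q -> 0 <= z s.
    by move=> sQ; case/andP: (yP s _ sQ (sigmaP s)).
  have z_flow : is_flow (pure_trans M sigma) (init M) (S_maybe M Q) z.
    move=> s sQ; rewrite -(inflow_supported y_supp) -flow //.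
    have := sum_enabled_supported sigmaP y_supp (fun=> 1) sQ.
    by under eq_bigr do rewrite mulr1; rewrite mulr1.
  (* With [S_zero] empty, the absorption equation would read 1 = 0. *)
  have [s0 s0S] : exists s, s \in S_zero M Q.
    apply/finset.set0Pn/eqP => S00; move: absorb; rewrite big1 => [/eqP|s _].
      by rewrite oner_eq0.
    by apply: big1 => al _; rewrite S00 big_set0 mulr0.
  have zE s : s \in S_maybe M Q ->
      z s = occupation (pure_trans M sigma) (init M) s.
    apply: (flow_unique (D := S_maybe M Q)) => //.
    - exact: pure_trans_ge0.
    - exact: pure_trans_closed.
    - exact: visits_fin.
    - by move=> t _; apply: pure_trans_sum.
    (* A nonempty closed [B] inside [S_maybe] would have to meet the closed set [S_zero], because
       there is only one end component. *)
    - move=> B BQ closedB; apply/eqP/negPn/negP => /finset.set0Pn[t tB].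
      have [u uB uS] := one_end_component_meet one_ec sigmaP tB closedB s0S
        (fun s t sS => S_zero_closed sS).
      by have := fintype.subsetP BQ u uB; rewrite in_S_maybe uS.
  exists sigma; split=> // j; rewrite Qtotal.
  rewrite (expected_total_pure Q sigmaP) sum_occupation //.
  - rewrite compare_sem_EFin; have [xj cmp] := xP j; move: cmp; rewrite xj.
    congr compare_sem; apply: eq_bigr => s sQ; rewrite -zE //.
    exact: (sum_enabled_supported sigmaP y_supp).
  - exact: pure_trans_ge0.
  - exact: visits_fin.
  - exact: pure_reward_ge0.
case=> sigma [sigmaP ach].
(* The solution puts the expected visits of each state on its chosen action. *)
pose occ := occupation (pure_trans M sigma) (init M).
pose y s al := (al == sigma s)%:R * occ s.
have y_supp s b :
    s \in S_maybe M Q -> enabled M s b -> b != sigma s -> y s b = 0.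
  by move=> _ _ /negbTE nb; rewrite /y nb mul0r.
have y_sigma s : y s (sigma s) = occ s by rewrite /y eqxx mul1r.
have occ_flow : is_flow (pure_trans M sigma) (init M) (S_maybe M Q) occ.
  apply: occupation_flow.
  - exact: pure_trans_ge0.
  - exact: pure_trans_closed.
  - exact: visits_fin.
exists (fun s al => (al == sigma s)%:R), y.
exists (\row_j \sum_(s in S_maybe M Q) occ s * pure_reward M Q sigma j s).
split.
- move=> s; split=> [al _|]; first by case: eqP; [right|left].
  rewrite (bigD1 (sigma s)) ?sigmaP //= eqxx big1 ?addr0 // => al /andP[_].
  by move=> /negbTE ->.
- move=> s al sQ _; rewrite /y; have [_|_] := eqVneq al (sigma s); last first.
    by rewrite mul0r mulr0 lexx.
  rewrite mul1r mulr1 occupation_ge0; last exact: pure_trans_ge0.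
  rewrite -lee_fin (occupationE (D := S_maybe M Q)) ?visits_le //.
  + exact: pure_trans_ge0.
  + exact: visits_fin.
- move=> s sQ; rewrite (inflow_supported y_supp).
  have := sum_enabled_supported sigmaP y_supp (fun=> 1) sQ.
  under eq_bigr do rewrite mulr1; rewrite mulr1 y_sigma => ->.
  by rewrite occ_flow //; congr (_ + _); apply: eq_bigr => t _; rewrite y_sigma.
(* The unit of flow enters at [init M], which lies in [S_maybe], and has to leave into [S_zero]. *)
- rewrite -[LHS](flow_absorption (fun s _ => pure_trans_sum sigmaP s)
    init_maybe occ_flow).
  apply: eq_bigr => s sQ; rewrite maybeC -y_sigma.
  by rewrite (sum_enabled_supported sigmaP y_supp
    (fun al => \sum_(s' in S_zero M Q) trans M s al s') sQ).
- move=> j; rewrite mxE; split.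
    apply: eq_bigr => s sQ; rewrite -y_sigma.
    by rewrite (sum_enabled_supported sigmaP y_supp
      (fun al => \sum_s' trans M s al s' * obj_reward (Q j) s al s') sQ).
  have := ach j; rewrite Qtotal (expected_total_pure Q sigmaP) sum_occupation //.
  + exact: pure_trans_ge0.
  + exact: visits_fin.
  + exact: pure_reward_ge0.
Qed.
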